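(* Let $G=\left(N,M,(A^i)_{i\in N},(\Xi_j)_{j\in M}\right)$ be a congestion game with $N=\{1,\dots,n\}$ and $M=\{1,\dots,m\}$, and let $P:A\to\mathbb{R}$ be its potential function $$P(a)=\sum_{j\in\bigcup_{i=1}^n a^i}\ \sum_{\ell=1}^{r_j(a)}\Xi_j(\ell).$$ Then $$P(a)=\Xi\, B^{\mathrm{T}}(a),\qquad a\in A.$$
   Context: A congestion game is a tuple $(N,M,(A^i)_{i\in N},(\Xi_j)_{j\in M})$, where $N=\{1,\dots,n\}$ is the set of players, $M=\{1,\dots,m\}$ is the finite set of facilities, $A^i\subset 2^M$ is the strategy set of player $i$ (each strategy is a subset of $M$), and $\Xi_j:\mathbb{R}\to\mathbb{R}$ is the facility-cost function of facility $j$. Profiles are $a=(a^1,\dots,a^n)\in A:=\prod_{i=1}^n A^i$. The number of users of facility $j$ is $r_j(a):=|\{i : j\in a^i\}|$. Vector notation: put $\xi^j_k:=\Xi_j(k)$ for $k=1,\dots,n$; identify $\Xi_j$ with the row vector $[\xi^j_1,\dots,\xi^j_n]$; and set $\Xi:=[\Xi_1,\dots,\Xi_m]\in\mathbb{R}^{mn}$ (a row vector). For $j=1,\dots,m$ let $$b_j(a):=[\underbrace{1,\dots,1}_{r_j(a)},\underbrace{0,\dots,0}_{n-r_j(a)}]\in\mathbb{R}^n,$$ and let $B(a):=[b_1(a),b_2(a),\dots,b_m(a)]\in\mathbb{R}^{mn}$ (a row vector). *)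

(* Defs.v *)
From mathcomp Require Import all_boot all_order all_algebra.
From mathcomp Require Import reals.

Set Implicit Arguments.
Unset Strict Implicit.
Unset Printing Implicit Defensive.

Import Order.TTheory GRing.Theory Num.Theory.
Local Open Scope ring_scope.

(* Players {1, ..., n} and facilities {1, ..., m} are numbered from 0. *)
Record congestion_game (R : realType) (n m : nat) := CongestionGame {
  strategies : 'I_n -> {set {set 'I_m}};
  facility_cost : 'I_m -> R -> R }.

Section CongestionGame.
Variables (R : realType) (n m : nat) (G : congestion_game R n m).

Definition profile : Type :=
  forall i : 'I_n, {s : {set 'I_m} | s \in strategies G i}.

Definition users (a : profile) (j : 'I_m) : nat :=
  #|[set i : 'I_n | j \in \val (a i)]|.

Definition potential (a : profile) : R :=
  \sum_(j in \bigcup_(i < n) \val (a i))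
    \sum_(1 <= l < (users a j).+1) facility_cost G j l%:R.

(* The entry at the 0-based position k is xi^j_(k+1) = Xi_j(k+1). *)
Definition cost_block (j : 'I_m) : 'rV[R]_n :=
  \row_(k < n) facility_cost G j k.+1%:R.

(* [Xi_1, ..., Xi_m]; its width \sum_(j < m) n is m * n. *)
Definition cost_vector : 'rV[R]_(\sum_(j < m) n) :=
  \mxrow_(j < m) cost_block j.

Definition usage_block (a : profile) (j : 'I_m) : 'rV[R]_n :=
  \row_(k < n) (if (k < users a j)%N then 1 else 0).

Definition usage_vector (a : profile) : 'rV[R]_(\sum_(j < m) n) :=
  \mxrow_(j < m) usage_block a j.

End CongestionGame.

(* Main.v *)
Require Import Defs.
From mathcomp Require Import all_boot all_order all_algebra.
From mathcomp Require Import reals.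

(** Both sides are sums over facilities.  The product of the two concatenated
    vectors splits into the products of their blocks, and the block product of
    [j] adds the first [users a j] costs of [j], because the 0/1 block cuts the
    sum off there ([cost_usage_block]).  The potential has the same inner sums
    but runs only over the facilities in use; the others have no users
    ([mem_bigcup_users]), so their inner sums are empty. *)

Set Implicit Arguments.
Unset Strict Implicit.
Unset Printing Implicit Defensive.

Import Order.TTheory GRing.Theory Num.Theory.
Local Open Scope ring_scope.

Lemma mem_bigcup_users (R : realType) (n m : nat) (G : congestion_game R n m)
    (a : profile G) (j : 'I_m) :
  (j \in \bigcup_(i < n) \val (a i)) = (0 < users a j)%N.
Proof.
rewrite /users card_gt0; apply/bigcupP/set0Pn => [[i _ ji] | [i]].
  by exists i; rewrite inE.
by rewrite inE => ji; exists i.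
Qed.

Lemma users_le (R : realType) (n m : nat) (G : congestion_game R n m)
    (a : profile G) (j : 'I_m) :
  (users a j <= n)%N.
Proof. by rewrite -[leqRHS]card_ord; apply: max_card. Qed.

(** The costs sit at 0-based positions, so the position [k] carries the cost
    at load [k.+1].  Since [users a j <= n], a block of [n] entries is long
    enough to hold all the terms of the right-hand side. *)
Lemma cost_usage_block (R : realType) (n m : nat) (G : congestion_game R n m)
    (a : profile G) (j : 'I_m) :
  (cost_block G j *m (usage_block a j)^T) 0 0 =
  \sum_(1 <= l < (users a j).+1) facility_cost G j l%:R.
Proof.
rewrite big_add1 /= big_mkord.
rewrite (big_ord_widen n (fun k => facility_cost G j k.+1%:R) (users_le a j)).
rewrite mxE [RHS]big_mkcond /=; apply: eq_bigr => k _.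
by rewrite !mxE; case: ifP => _; rewrite ?mulr1 ?mulr0.
Qed.

Theorem mainTheorem2 (R : realType) (n m : nat) (G : congestion_game R n m)
    (a : profile G) :
  potential a = (cost_vector G *m (usage_vector a)^T) 0 0.
Proof.
rewrite /cost_vector /usage_vector tr_mxrow mul_mxrow_mxcol summxE /potential.
rewrite [LHS]big_mkcond /=; apply: eq_bigr => j _.
rewrite cost_usage_block mem_bigcup_users.
by case: posnP => [-> | //]; rewrite big_geq.
Qed.
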